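(* Let $P_{\mathcal{D}}$ be a probability measure on $(\mathcal{D},\mathcal{B}_{\mathcal{D}})$, absolutely continuous with respect to $\mu_{\mathcal{D}}$, with density $\rho_{\mathcal{D}}$, and suppose a $\mathcal{B}_{\Lambda}$-consistent rule for generating samples in $\Lambda$ is given. Then for any event $A\in\mathcal{B}_{\Lambda}$ with $\mu_{\Lambda}(\partial A)=0$, there exists a sequence of simple function approximations $\rho_{\mathcal{D},M}$ of $\rho_{\mathcal{D}}$ and associated counting measures $\tilde{P}_{\Lambda,N}$ (built from $N$ samples produced by the rule and from $\rho_{\mathcal{D},M}$) such that $\tilde{P}_{\Lambda,N}(A)\to P_{\Lambda}(A)$ almost surely as $N,M\to\infty$.
   Context: Setting. $\Lambda\subset\mathbb{R}^n$ is a metric space with Borel $\sigma$-algebra $\mathcal{B}_{\Lambda}$ and volume measure $\mu_{\Lambda}$ induced by the metric, with $\mu_\Lambda(\Lambda)<\infty$ ($\Lambda$ compact). $Q:\Lambda\to\mathbb{R}^m$, $m\le n$, is locally differentiable and its Jacobian has full rank at every point of $\Lambda$. $\mathcal{D}:=Q(\Lambda)$ has Borel $\sigma$-algebra $\mathcal{B}_{\mathcal{D}}$ and push-forward volume measure $\mu_{\mathcal{D}}(E)=\mu_{\Lambda}(Q^{-1}(E))$. Generalized contours. The sets $Q^{-1}(q)$, $q\in\mathcal{D}$, are the equivalence classes of the relation $\lambda\sim\lambda' \iff Q(\lambda)=Q(\lambda')$. $\mathcal{L}$ is the set of equivalence classes, $\pi_{\mathcal{L}}:\Lambda\to\mathcal{L}$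 is the projection, and $C_{\ell}:=\pi_{\mathcal{L}}^{-1}(\ell)$. $\mathcal{L}$ is in bijection with $\mathcal{D}$; $\mathcal{B}_{\mathcal{L}},\mu_{\mathcal{L}},P_{\mathcal{L}}$ are obtained from $\mathcal{B}_{\mathcal{D}},\mu_{\mathcal{D}},P_{\mathcal{D}}$ via this bijection. $\mathcal{B}_{C_\ell}=\{E\cap C_\ell: E\in\mathcal{B}_\Lambda\}$, and $\{\mu_{C_\ell}\}$ is the family of measures on $(C_\ell,\mathcal{B}_{C_\ell})$ with $\mu_{\Lambda}(E)=\int_{\pi_{\mathcal{L}}(E)}\mu_{C_\ell}(C_\ell\cap E)\,d\mu_{\mathcal{L}}(\ell)$ for all $E\in\mathcal{B}_\Lambda$. Exact measure. $P_{\Lambda}$ is the solution of the stochastic inverse problem under the standard Ansatz $P_\ell=\mu_{C_\ell}/\mu_{C_\ell}(C_\ell)$ for all $\ell\in\mathcal{L}$, i.e. $P_{\Lambda}(E)=\int_{\pi_{\mathcal{L}}(E)}P_\ell(C_\ell\cap E)\,dP_{\mathcal{L}}(\ell)$ for $E\in\mathcal{B}_\Lambda$. Simple function approximation. For a finite measurable partition $\{I_i\}_{i=1}^M$ of $\mathcal{D}$, put $p_i=P_{\mathcal{D}}(I_i)$, and let $\rho_{\mathcal{D},M}$ be the normalized simple function, constant on each $I_i$, that gives $I_i$ probability $p_i$ (its value on $I_i$ is $p_i/\mu_{\mathcal{D}}(I_i)$). Put $A_i:=Q^{-1}(I_i)$. Voronoi cells. For samples $\{\lambda^{(j)}\}_{j=1}^N\subset\Lambda$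 and a metric $d_v$ on $\Lambda$, $\mathcal{V}_j=\mathcal{V}(\lambda^{(j)}):=\{\lambda\in\Lambda: d_v(\lambda^{(j)},\lambda)\le d_v(\lambda^{(i)},\lambda),\ i=1,\dots,N\}$. The Voronoi coverage of $E\in\mathcal{B}_\Lambda$ is $E_N:=\bigcup_{\lambda^{(j)}\in E,\,1\le j\le N}\mathcal{V}(\lambda^{(j)})$. A (possibly random) rule for defining any $N$ samples is $\mathcal{B}_\Lambda$-consistent if $\mu_\Lambda(E\triangle E_N)\to0$ as $N\to\infty$ for all $E\in\mathcal{B}_\Lambda$ with $\mu_\Lambda(\partial E)=0$ (almost surely, if the rule is random). Counting measure. With $V_{ij}=\mu_\Lambda(A_i\cap\mathcal{V}_j)$ set $P_{\Lambda,N}(\mathcal{V}_j)=\sum_{i=1}^M p_i\,V_{ij}/\sum_{k=1}^N V_{ik}$, and define $\tilde{P}_{\Lambda,N}(E):=\sum_{j:\ \lambda^{(j)}\in E}P_{\Lambda,N}(\mathcal{V}_j)$ for $E\in\mathcal{B}_\Lambda$.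
   Formalization: Added assumption: almost surely, for every N, any two Voronoi cells with different indices overlap in a set of zero volume; without it the claim fails (e.g. listing every sample in A twice). Distance functions of d_v are also assumed Borel measurable. *)

(* Defs.v *)
From HB Require Import structures.
From mathcomp Require Import all_boot all_order all_algebra.
From mathcomp Require Import all_classical all_reals all_analysis measurable_realfun.
Set Implicit Arguments.
Unset Strict Implicit.
Unset Printing Implicit Defensive.
Import Order.TTheory GRing.Theory Num.Theory.
Import numFieldNormedType.Exports.
Local Open Scope classical_set_scope.
Local Open Scope ring_scope.

(* ['rV[R]_k] carries the sup norm, whose open sets are the Euclidean ones. *)
Definition borelRV (R : realType) (k : nat) :=
  g_sigma_algebraType (@open ('rV[R]_k)).

(* Lebesgue measure is the only Borel measure with these values. *)
Definition is_lebesgue (R : realType) (n : nat)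
    (mu : set (borelRV R n) -> \bar R) : Prop :=
  forall a b : 'rV[R]_n, (forall i, a ord0 i <= b ord0 i) ->
    mu [set x : 'rV[R]_n | forall i, a ord0 i <= x ord0 i <= b ord0 i]
    = (\prod_i (b ord0 i - a ord0 i))%:E.

Definition borel_on (R : realType) (k : nat) (S : set 'rV[R]_k) :
    set (set (borelRV R k)) :=
  [set F `&` S | F in (measurable : set (set (borelRV R k)))].

Definition boundary_in (T : topologicalType) (S E : set T) : set T :=
  S `&` closure E `&` closure (S `\` E).

(* [Q] is differentiable on the arbitrary set [L] in the usual sense: near each
   point it agrees on [L] with a map differentiable on an open set.  As
   [m <= n], full rank of the Jacobian means rank [m]. *)
Definition locally_differentiable_full_rank (R : realType) (n m : nat)
    (L : set 'rV[R]_n) (Q : 'rV[R]_n -> 'rV[R]_m) : Prop :=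
  forall x, L x -> exists (U : set 'rV[R]_n) (g : 'rV[R]_n -> 'rV[R]_m),
    [/\ open U, U x, forall y, U y -> L y -> g y = Q y,
        forall y, U y -> differentiable g y
      & \rank (jacobian g x) = m].

Section contours.
Context (R : realType) (n m : nat).
Variables (L : set 'rV[R]_n) (Q : 'rV[R]_n -> 'rV[R]_m).

Definition outputs : set 'rV[R]_m := Q @` L.

Definition preimageQ (F : set 'rV[R]_m) : set 'rV[R]_n := L `&` Q @^-1` F.

Definition push_volume (mu : set (borelRV R n) -> \bar R) :
    set (borelRV R m) -> \bar R :=
  fun F => mu (preimageQ F).

Definition contour_proj (x : 'rV[R]_n) : set 'rV[R]_n :=
  [set y | L y /\ Q y = Q x].

Definition contours : set (set 'rV[R]_n) := contour_proj @` L.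

Definition contour_set (l : set 'rV[R]_n) : set 'rV[R]_n :=
  L `&` contour_proj @^-1` [set l].

(* The bijection from [outputs] to [contours]. *)
Definition contour_of_output (q : 'rV[R]_m) : set 'rV[R]_n :=
  preimageQ [set q].

(* Equivalence classes, as sets of points, with the sigma-algebra transported
   from [outputs]: the image system is already a sigma-algebra, whose sets
   contained in [contours] are the images of the Borel subsets of [outputs]. *)
Definition contourType := g_sigma_algebraType
  (image_set_system outputs contour_of_output
     (measurable : set (set (borelRV R m)))).

Definition transport (nu : set (borelRV R m) -> \bar R) :
    set contourType -> \bar R :=
  fun G => nu (outputs `&` contour_of_output @^-1` G).

(* A measure on the contour [l] is a Borel measure on the whole space of which
   only the values on subsets of [contour_set l] are used. *)
Definition is_disintegration (mu : set (borelRV R n) -> \bar R)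
    (muC : contourType -> {measure set (borelRV R n) -> \bar R}) : Prop :=
  forall E, borel_on L E ->
    measurable_fun (contours : set contourType)
      (fun l => muC l (contour_set l `&` E)) /\
    mu E = (\int[transport (push_volume mu)]_(l in contour_proj @` E)
              muC l (contour_set l `&` E))%E.

Definition ansatz (muC : contourType -> set (borelRV R n) -> \bar R)
    (l : contourType) : set (borelRV R n) -> \bar R :=
  fun E => (muC l E / muC l (contour_set l))%E.

Definition inverse_measure (muC : contourType -> set (borelRV R n) -> \bar R)
    (PD : set (borelRV R m) -> \bar R) : set (borelRV R n) -> \bar R :=
  fun E => (\int[transport PD]_(l in contour_proj @` E)
              ansatz muC l (contour_set l `&` E))%E.

End contours.

(* Cells may be empty. *)
Definition is_borel_partition (R : realType) (m M : nat) (D : set 'rV[R]_m)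
    (I : 'I_M -> set 'rV[R]_m) : Prop :=
  [/\ forall i, borel_on D (I i), \bigcup_i I i = D & trivIset setT I].

(* A cell with [muD]-measure zero gets the value [0], as [x / 0 = 0]. *)
Definition simple_density (R : realType) (m M : nat)
    (muD PD : set (borelRV R m) -> \bar R) (I : 'I_M -> set 'rV[R]_m) :
    'rV[R]_m -> R :=
  fun q => \sum_i fine (PD (I i)) / fine (muD (I i)) * \1_(I i) q.

(* Borel measurability of the distance functions makes the Voronoi cells Borel
   sets; it holds when [dv] is continuous. *)
Definition is_borel_metric_on (R : realType) (n : nat) (L : set 'rV[R]_n)
    (dv : 'rV[R]_n -> 'rV[R]_n -> R) : Prop :=
  [/\ forall x y, L x -> L y -> 0 <= dv x y,
      forall x y, L x -> L y -> (dv x y = 0 <-> x = y),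
      forall x y, L x -> L y -> dv x y = dv y x,
      forall x y z, L x -> L y -> L z -> dv x z <= dv x y + dv y z
    & forall x, L x -> measurable_fun (L : set (borelRV R n)) (dv x)].

Section voronoi.
Context (R : realType) (n : nat).
Variables (L : set 'rV[R]_n) (dv : 'rV[R]_n -> 'rV[R]_n -> R).
Context (N : nat).
Variable lam : 'I_N -> 'rV[R]_n.

Definition voronoi (j : 'I_N) : set 'rV[R]_n :=
  [set x | L x /\ forall i, dv (lam j) x <= dv (lam i) x].

Definition voronoi_coverage (E : set 'rV[R]_n) : set 'rV[R]_n :=
  \bigcup_(j in [set j | E (lam j)]) voronoi j.

(* The cells share boundary points.  That the shared part is null holds for
   distinct samples and the Euclidean distance, but fails for repeated samples
   and for some metrics with thick bisectors such as the sup distance; the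
   counting measure would then count the shared part several times. *)
Definition is_voronoi_tessellation (mu : set (borelRV R n) -> \bar R) : Prop :=
  forall i j, i != j -> mu (voronoi i `&` voronoi j) = 0%E.

End voronoi.

Definition is_sampling_rule (R : realType) (n : nat) (L : set 'rV[R]_n)
    (d : measure_display) (Omega : measurableType d)
    (lam : forall N : nat, 'I_N -> Omega -> 'rV[R]_n) : Prop :=
  forall N (j : 'I_N),
    measurable_fun [set: Omega] (lam N j : Omega -> borelRV R n) /\
    forall w, L (lam N j w).

(* A deterministic rule is the case where [lam N j] is constant. *)
Definition consistent_rule (R : realType) (n : nat) (L : set 'rV[R]_n)
    (mu : set (borelRV R n) -> \bar R) (dv : 'rV[R]_n -> 'rV[R]_n -> R)
    (d : measure_display) (Omega : measurableType d) (P : probability Omega R)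
    (lam : forall N : nat, 'I_N -> Omega -> 'rV[R]_n) : Prop :=
  forall E, borel_on L E -> mu (boundary_in L E) = 0%E ->
    {ae P, forall w,
      mu (E `+` voronoi_coverage L dv (fun j : 'I_N => lam N j w) E)
        @[N --> \oo] --> 0%E}.

Section counting_measure.
Context (R : realType) (n m M N : nat).
Variables (L : set 'rV[R]_n) (Q : 'rV[R]_n -> 'rV[R]_m).
Variables (mu : set (borelRV R n) -> \bar R) (PD : set (borelRV R m) -> \bar R).
Variables (I : 'I_M -> set 'rV[R]_m).
Variables (dv : 'rV[R]_n -> 'rV[R]_n -> R) (lam : 'I_N -> 'rV[R]_n).

Definition cell_volume (i : 'I_M) (j : 'I_N) : R :=
  fine (mu (preimageQ L Q (I i) `&` voronoi L dv lam j)).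

Definition cell_probability (j : 'I_N) : R :=
  \sum_i fine (PD (I i)) * (cell_volume i j / \sum_k cell_volume i k).

Definition counting_measure (E : set 'rV[R]_n) : R :=
  \sum_(j | lam j \in E) cell_probability j.

End counting_measure.

(* Main.v *)
Require Import Defs.
From HB Require Import structures.
From mathcomp Require Import all_boot all_order all_algebra.
From mathcomp Require Import all_classical all_reals all_analysis measurable_realfun.
Import Order.TTheory GRing.Theory Num.Theory.
Import numFieldNormedType.Exports.
Local Open Scope classical_set_scope.
Local Open Scope ring_scope.

(* Disintegrating preimages of Borel sets of outputs shows that [muD]-almost every
   contour has mass 1, so the Ansatz gives [PLambda A = \int_A rhoD o Q dmu].
   If [rhoM] is the simple density and [A_N] the Voronoi coverage of [A], the
   counting measure of [A] is [\int_(A_N) rhoM o Q dmu].  The two differ by at most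
   [\int |rhoM - rhoD| dmuD + \int_(A + A_N) rhoD o Q dmu], where [A + A_N] is the
   symmetric difference.  The first term does not depend on [N] and tends to 0 when
   the cells are level sets of [rhoD]; the second does not depend on [M] and tends
   to 0 by consistency and absolute continuity of the integral, so the limit in
   [(N, M)] is a joint one. *)

(** * Images of measures under maps that are measurable on a subset *)

Section image_measure.
Local Open Scope ereal_scope.
Context {d1 d2} {T1 : measurableType d1} {T2 : measurableType d2}
  {R : realType}.
Variables (nu : {measure set T1 -> \bar R}) (D : set T1) (f : T1 -> T2).
Hypotheses (mD : measurable D) (mf : measurable_fun D f).

(** The map is only assumed measurable on [D], as [Q] is on [L]. By conversion this is [push_volume]
    for [D = L] and [f = Q], and [transport] for [D = outputs L Q] and
    [f = contour_of_output L Q]. *)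
Definition image_measure (F : set T2) : \bar R := nu (D `&` f @^-1` F).

Let image_measure0 : image_measure set0 = 0.
Proof. by rewrite /image_measure preimage_set0 setI0 measure0. Qed.

Let image_measure_ge0 F : 0 <= image_measure F.
Proof. exact: measure_ge0. Qed.

Let image_measure_sigma_additive : semi_sigma_additive image_measure.
Proof.
move=> F mF tF mUF; rewrite /image_measure preimage_bigcup setI_bigcupr.
apply: measure_semi_sigma_additive.
- by move=> n; exact: mf.
- apply/trivIsetP => /= i j _ _ ij; rewrite setIACA setIid -preimage_setI.
  by move/trivIsetP : tF => /(_ _ _ _ _ ij) ->//; rewrite preimage_set0 setI0.
- by rewrite -setI_bigcupr -preimage_bigcup; exact: mf.
Qed.

HB.instance Definition _ := isMeasure.Build _ _ _ image_measure
  image_measure0 image_measure_ge0 image_measure_sigma_additive.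

(** The measure structure rests on [mD] and [mf], which unification cannot find, so this version
    takes them as explicit arguments. *)
Definition image_measure_of : {measure set T2 -> \bar R} := image_measure.

End image_measure.

(** * Change of variables with a density *)

Section integral_image_density.
Local Open Scope ereal_scope.
Context {d1 d2} {T1 : measurableType d1} {T2 : measurableType d2}
  {R : realType}.
Variables (nu : {measure set T1 -> \bar R}) (kappa : {measure set T2 -> \bar R}).
Variables (D : set T1) (f : T1 -> T2) (g : T1 -> \bar R).
Hypotheses (mD : measurable D) (mf : measurable_fun D f).
Hypotheses (mg : measurable_fun D g) (g0 : forall x, D x -> 0 <= g x).
Hypothesis kappaE : forall F, measurable F ->
  kappa F = \int[nu]_(x in D `&` f @^-1` F) g x.

Import HBNNSimple.

Let integral_nnsfun_image_density (h : {nnsfun T2 >-> R}) :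
  \int[kappa]_y (h y)%:E = \int[nu]_(x in D) ((h (f x))%:E * g x).
Proof.
have mh k : measurable (h @^-1` [set k]) by [].
have mDh k : measurable (D `&` f @^-1` (h @^-1` [set k])) by exact: mf.
have mi k : measurable_fun D (fun x => (\1_(h @^-1` [set k]) (f x))%:E : \bar R).
  apply/measurable_EFinP/(@measurableT_comp _ _ _ _ _ _ (\1_(h @^-1` [set k]) : T2 -> R)) => //.
rewrite integralT_nnsfun sintegralE.
transitivity (\sum_(k \in range h)
  \int[nu]_(x in D) (k%:E * ((\1_(h @^-1` [set k]) (f x))%:E * g x))).
  apply: eq_fsbigr => k /[!inE] -[y _ hyk].
  rewrite ge0_integralZl//; last 3 first.
  - exact: emeasurable_funM.
  - by move=> x Dx; rewrite mule_ge0 ?g0// lee_fin.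
  - by rewrite lee_fin -hyk.
  congr (_ * _); rewrite kappaE// integral_mkcondr; apply: eq_integral => x _.
  rewrite patchE indicE; have -> : (x \in f @^-1` (h @^-1` [set k])) = (f x \in h @^-1` [set k]).
    by apply/idP/idP; rewrite !inE.
  by case: ifP => _; rewrite ?mul1e ?mul0e.
rewrite -ge0_integral_fsum//.
- apply: eq_integral => x _; rewrite fimfunE -fsumEFin// ge0_mule_fsuml.
    by apply: eq_fsbigr => k _; rewrite EFinM muleA.
  by move=> k; rewrite lee_fin; exact: nnfun_muleindic_ge0.
- by move=> k; apply: measurable_funeM; exact: emeasurable_funM.
- move=> k x Dx; rewrite muleA mule_ge0 ?g0//.
  by rewrite -EFinM lee_fin; exact: nnfun_muleindic_ge0.
Qed.

(** [kappa] is the image under [f] of the measure of density [g] with respect to [nu]. Indicators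
    are the hypothesis [kappaE], simple functions follow by additivity, and monotone convergence
    gives the rest. *)
Lemma ge0_integral_image_density (h : T2 -> \bar R) :
  measurable_fun setT h -> (forall y, 0 <= h y) ->
  \int[kappa]_y h y = \int[nu]_(x in D) (h (f x) * g x).
Proof.
move=> mh h0; pose h_ := nnsfun_approx measurableT mh.
have h_cvg y : EFin \o h_ ^~ y @ \oo --> h y by exact: cvg_nnsfun_approx.
have h_nd y : {homo (fun n => (h_ n y)%:E) : m n / (m <= n)%N >-> m <= n}.
  by move=> m n mn; rewrite lee_fin; exact/lefP/nd_nnsfun_approx.
transitivity (limn (fun n => \int[kappa]_y (h_ n y)%:E)).
  rewrite -monotone_convergence//.
  - by apply: eq_integral => y _; apply/esym/cvg_lim => //; exact: h_cvg.
  - by move=> n; exact/measurable_EFinP/measurable_funP.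
  - by move=> n y _; rewrite lee_fin.
under eq_fun do rewrite integral_nnsfun_image_density.
rewrite -monotone_convergence//; last 3 first.
- move=> n; apply: emeasurable_funM => //; apply/measurable_EFinP.
  exact: measurableT_comp.
- by move=> n x Dx; rewrite mule_ge0 ?g0// lee_fin.
- by move=> x Dx m n mn; rewrite lee_wpmul2r ?g0//; exact: h_nd.
apply: eq_integral => x /[!inE] Dx; apply/cvg_lim => //.
(* [g x] may be infinite, and [+oo * _] is not continuous at [0]. *)
have := g0 _ Dx; case: (g x) => [r r0| _|//]; first exact/cvgeZr/h_cvg.
have [h_0|/existsNP[N /eqP hN0]] := pselect (forall n, h_ n (f x) = 0%R).
  have -> : h (f x) = 0.
    apply: (cvg_unique _ (h_cvg (f x))) => //.
    by apply: cvg_near_cst; apply: nearW => n /=; rewrite h_0.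
  by rewrite mul0e; apply: cvg_near_cst; apply: nearW => n; rewrite h_0 mul0e.
have hN n : (N <= n)%N -> 0 < (h_ n (f x))%:E.
  move=> Nn; apply: lt_le_trans (h_nd _ _ _ Nn).
  by rewrite lte_fin lt0r hN0/=.
rewrite gt0_muley; last first.
  apply: lt_le_trans (hN _ (leqnn N)) _.
  rewrite -(cvg_lim _ (h_cvg (f x)))//.
  apply: lime_ge; first by apply/cvg_ex; eexists; exact: h_cvg.
  by near=> n; apply: h_nd; near: n; exact: nbhs_infty_ge.
apply: cvg_near_cst; near=> n; rewrite gt0_muley// hN//.
by near: n; exact: nbhs_infty_ge.
Unshelve. all: by end_near. Qed.

End integral_image_density.

Section integral_image_measure.
Local Open Scope ereal_scope.
Context {d1 d2} {T1 : measurableType d1} {T2 : measurableType d2}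
  {R : realType}.
Variables (nu : {measure set T1 -> \bar R}) (D : set T1) (f : T1 -> T2).
Hypotheses (mD : measurable D) (mf : measurable_fun D f).

(** The previous formula with density [cst 1]. *)
Lemma ge0_integral_image_measure (h : T2 -> \bar R) :
  measurable_fun setT h -> (forall y, 0 <= h y) ->
  \int[image_measure nu D f]_y h y = \int[nu]_(x in D) h (f x).
Proof.
move=> mh h0.
have kappaE F : measurable F -> image_measure_of nu D f mD mf F =
    \int[nu]_(x in D `&` f @^-1` F) cst 1 x.
  by move=> mF; rewrite integral_cst ?mul1e//; exact: mf.
have := ge0_integral_image_density nu (image_measure_of nu D f mD mf) D f
  (cst 1) mD mf (measurable_cst _) (fun _ _ => lee01) kappaE h mh h0.
by under [in X in _ = X -> _]eq_integral do rewrite mule1.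
Qed.

End integral_image_measure.

(** * Approximation in L1 of a function by its averages over level sets *)

Section level_partition.
Context {d} {T : measurableType d} {R : realType}.
Variables (nu : {measure set T -> \bar R}) (D : set T) (f : T -> R).
Hypotheses (mD : measurable D) (nuD : (nu D < +oo)%E).
Hypotheses (f0 : forall x, D x -> 0 <= f x).
Hypothesis intf : nu.-integrable D (EFin \o f).

Let mf : measurable_fun D f.
Proof. by apply/measurable_EFinP; exact: measurable_int intf. Qed.

(* With [a] the average of [f], [|a - s| nu I = |\int_I (f - s)|] is at most the
   integral of [|f - s|]. *)
Lemma integral_dist_average_le (I : set T) (s : R) :
  measurable I -> I `<=` D ->
  (\int[nu]_(x in I)
      `|fine (\int[nu]_(x in I) (f x)%:E) / fine (nu I) - f x|%:E <=
   2%:E * \int[nu]_(x in I) `|f x - s|%:E)%E.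
Proof.
move=> mI ID; set a := _ / _.
have nuI : nu I \is a fin_num.
  by rewrite ge0_fin_numE// (le_lt_trans _ nuD)// le_measure ?inE.
have mfI : measurable_fun I f by exact: measurable_funS mf.
have intI : nu.-integrable I (EFin \o f) by exact: integrableS intf.
have ints : nu.-integrable I (EFin \o cst s).
  apply/integrableP; split; first exact/measurable_EFinP.
  suff : (\int[nu]_(x in I) cst `|s|%:E x < +oo)%E by [].
  by rewrite integral_cst// lte_mul_pinfty// ltey_eq nuI.
have intB : nu.-integrable I (fun x => (f x - s)%:E).
  by apply: eq_integrable (integrableB mI intI ints).
have mabs c : measurable_fun I (fun x => `|f x - c|%:E).
  by apply/measurable_EFinP/measurableT_comp => //; exact: measurable_funB.
apply: (@le_trans _ _ (\int[nu]_(x in I) (`|a - s|%:E + `|f x - s|%:E))%E).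
  apply: ge0_le_integral => //.
  - apply/measurable_EFinP/measurableT_comp => //; exact: measurable_funB.
  - by apply: emeasurable_funD.
  - move=> x Ix; rewrite -EFinD lee_fin.
    by rewrite (le_trans _ (ler_normB _ _))// opprB addrA subrK.
rewrite ge0_integralD//.
rewrite -[X in (X%:E * _)%E]/(1 + 1) EFinD ge0_muleDl// mul1e leeD2r//.
suff : (\int[nu]_(x in I) cst `|a - s|%:E x <= \int[nu]_(x in I) `|f x - s|%:E)%E by [].
rewrite integral_cst// -(fineK nuI) -EFinM.
(* On a null cell [a] is the default value of a division by 0, but it is multiplied by
   [nu I = 0]. *)
have [nuI0|nuI0] := eqVneq (fine (nu I)) 0.
  by rewrite nuI0 mulr0 integral_ge0.
have fI0 : 0 <= fine (nu I) by rewrite fine_ge0.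
rewrite -[X in (_ * X)%:E](ger0_norm fI0) -normrM mulrBl /a divfK//.
have -> : fine (\int[nu]_(x in I) (f x)%:E) - s * fine (nu I) =
          fine (\int[nu]_(x in I) (f x - s)%:E)%E.
  apply: EFin_inj; rewrite EFinB fineK ?integrable_fin_num//.
  rewrite fineK; last exact: integrable_fin_num.
  under [RHS]eq_integral do rewrite EFinB.
  rewrite integralB_EFin//.
  by rewrite -[X in _ = (_ - X)%E]/(\int[nu]_(x in I) cst s%:E x)%E integral_cst// EFinM fineK.
rewrite -[leLHS]/(`|(fine _)%:E|%E) fineK; last exact: integrable_fin_num.
by apply: le_abse_integral => //; apply/measurable_EFinP/measurable_funB.
Qed.

(* The cells number [M.+1], so that the width must tend to [0] while the height
   [M * level_width M] of the top cell tends to infinity. *)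
Definition level_width (M : nat) : R := (Num.sqrt M.+1%:R)^-1.

(** The upper bound is imposed only for [i < M]: the top cell takes all large values, so finitely
    many cells cover [D] even if [f] is unbounded. *)
Definition level_set (M : nat) (i : 'I_M.+1) : set T :=
  D `&` [set x | i%:R * level_width M <= f x /\
                 ((i < M)%N -> f x < i.+1%:R * level_width M)].

Lemma level_width_gt0 M : 0 < level_width M.
Proof. by rewrite invr_gt0 sqrtr_gt0. Qed.

Lemma measurable_level_set M (i : 'I_M.+1) : measurable (level_set M i).
Proof.
have [iM|Mi] := ltnP i M.
  have -> : level_set M i = D `&` f @^-1` `[i%:R * level_width M, i.+1%:R * level_width M[.
    apply/seteqP; split=> x [Dx] /=; rewrite in_itv/=.
      by move=> [-> fx]; rewrite fx.
    by move=> /andP[? ?]; split.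
  by apply: mf.
have -> : level_set M i = D `&` f @^-1` `[i%:R * level_width M, +oo[.
  apply/seteqP; split=> x [Dx] /=; rewrite in_itv/= andbT.
    by move=> [].
  by move=> ?; split => //; split => // iM; move: Mi; rewrite leqNgt iM.
by apply: mf.
Qed.

Lemma trivIset_level_set M : trivIset setT (level_set M).
Proof.
suff H (i j : 'I_M.+1) x : (i < j)%N -> level_set M i x -> level_set M j x -> False.
  move=> i j _ _ [x [ix jx]]; apply/eqP; rewrite -val_eqE.
  by case: ltngtP => // ij; [case: (H i j x)|case: (H j i x)].
move=> ij [_ [_ fi]] [_ [fj _]].
have iM : (i < M)%N by rewrite (leq_trans ij)// -ltnS.
have := le_lt_trans fj (fi iM).
by rewrite ltr_pM2r ?level_width_gt0// ltr_nat ltnS leqNgt ij.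
Qed.

Lemma bigcup_level_set M : \bigcup_i level_set M i = D.
Proof.
apply/seteqP; split=> [x [i _ []]//|x Dx].
have w0 := level_width_gt0 M.
(* The index is the integer part of [f x / level_width M], capped at the top cell [M]. *)
pose k := Num.truncn (f x / level_width M).
have /andP[kf fk] : k%:R <= f x / level_width M < k.+1%:R.
  by apply: truncn_itv; rewrite divr_ge0 ?f0// ltW.
have kM : (minn k M < M.+1)%N by rewrite ltnS geq_minr.
exists (Ordinal kM) => //; split => //=; split.
  rewrite -ler_pdivlMr// (le_trans _ kf)// ler_nat geq_minl//.
rewrite gtn_min ltnn orbF => kM'; rewrite (minn_idPl (ltnW kM')).
by rewrite -ltr_pdivrMr.
Qed.

Let bigcup_bigsetU n (I : 'I_n -> set T) :
  \bigcup_i I i = D -> D = \big[setU/set0]_(i <- index_enum 'I_n) I i.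
Proof.
move=> <-; rewrite -bigcup_seq; apply: eq_bigcup => //.
by split=> i //= _; rewrite mem_index_enum.
Qed.

(** On each cell exactly one indicator of the sum is nonzero. *)
Lemma integral_simple_dist n (I : 'I_n -> set T) (a : 'I_n -> R) :
  (forall i, measurable (I i)) -> trivIset setT I -> \bigcup_i I i = D ->
  (\int[nu]_(x in D) `|\sum_i a i * \1_(I i) x - f x|%:E =
   \sum_i \int[nu]_(x in I i) `|a i - f x|%:E)%E.
Proof.
move=> mI tI ID.
have DE := bigcup_bigsetU _ _ ID.
rewrite {1}DE ge0_integral_bigsetU//.
- apply: eq_bigr => i _; apply: eq_integral => x /[!inE] Iix.
  rewrite (bigD1 i)//= big1 ?addr0 ?indicE ?mem_set// ?mulr1// => j ji.
  rewrite indicE memNset ?mulr0// => Ijx; move/negP: ji; apply; apply/eqP.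
  by apply: (tI j i) => //; exists x.
- exact: index_enum_uniq.
- exact: sub_trivIset tI.
- rewrite -DE; apply/measurable_EFinP/measurableT_comp => //.
  apply: measurable_funB => //; apply: measurable_sum => i.
  exact: measurable_funM.
Qed.

Let sqrt_gt_near (c : R) : \forall M \near \oo, c < Num.sqrt M.+1%:R.
Proof.
near=> M; rewrite (le_lt_trans (ler_norm c))// -sqrtr_sqr ltr_sqrt//.
apply: (lt_le_trans (truncnS_gt (c ^+ 2))); rewrite ler_nat ltnS.
by near: M; exact: nbhs_infty_ge.
Unshelve. all: by end_near. Qed.

(** Bounds the distance from [f] to one constant per cell: below the top cell the constant is the
    lower end and the error at most the width; on the top cell the constant is 0 and the error is
    [f] itself. *)
Let tail_width M x : R :=
  level_width M + (if M%:R * level_width M <= f x then f x else 0).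

Let measurable_tail_width M : measurable_fun D (tail_width M).
Proof.
apply: measurable_funD => //; apply: measurable_fun_if => //.
  exact: measurable_fun_ler.
by apply: measurable_funS mf => // x [].
Qed.

Let tail_width_cvg x : D x -> tail_width M x @[M --> \oo] --> 0.
Proof.
move=> Dx; apply/cvgrPdist_lt => e e0; near=> M.
have fM : f x + 1 < Num.sqrt M.+1%:R by near: M; exact: sqrt_gt_near.
have wM : e^-1 < Num.sqrt M.+1%:R by near: M; exact: sqrt_gt_near.
have w0 := level_width_gt0 M.
have sM : level_width M * Num.sqrt M.+1%:R = 1.
  by rewrite mulVf// gt_eqF// sqrtr_gt0.
have fMw : f x < M%:R * level_width M.
  (* With [s] the square root of [M + 1], the height [M / s] is at least [s - 1], because
     [s ^ 2 - s = M + 1 - s <= M]. *)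
  apply: (@lt_le_trans _ _ (Num.sqrt M.+1%:R - 1)); first by rewrite ltrBrDr.
  rewrite -(ler_pM2r (x := Num.sqrt M.+1%:R)) ?sqrtr_gt0//.
  rewrite -mulrA sM mulr1 mulrBl mul1r -expr2 sqr_sqrtr//.
  by rewrite -natr1 lerBlDr lerD2l -[leLHS]sqrtr1 ler_wsqrtr// lerDr ler0n.
rewrite /tail_width leNgt fMw/= addr0 sub0r normrN gtr0_norm//.
by rewrite /level_width invf_plt// posrE sqrtr_gt0.
Unshelve. all: by end_near. Qed.

Let level_width_le1 M : level_width M <= 1.
Proof.
by rewrite invf_le1 ?sqrtr_gt0// -[leLHS]sqrtr1 ler_sqrt// ler1n.
Qed.

(** Dominated convergence with the bound [1 + f], integrable because [nu D] is finite. *)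
Let integral_tail_width_cvg :
  (\int[nu]_(x in D) (tail_width M x)%:E)%E @[M --> \oo] --> 0%E.
Proof.
have intD : nu.-integrable D (fun x => (1 + f x)%:E).
  have int1 : nu.-integrable D (EFin \o cst (1 : R)).
    apply/integrableP; split; first exact/measurable_EFinP.
    suff : (\int[nu]_(x in D) cst `|1%:E| x < +oo)%E by [].
    by rewrite integral_cst// lte_mul_pinfty.
  by apply: eq_integrable (integrableD mD int1 intf).
have tail0 M x : D x -> 0 <= tail_width M x.
  move=> Dx; rewrite /tail_width addr_ge0// ?(ltW (level_width_gt0 M))//.
  by case: ifP => // _; exact: f0.
have [] := @dominated_convergence _ _ _ nu D mD
  (fun M x => (tail_width M x)%:E) (cst 0%E) _ _ _ _ intD.
- by move=> M; exact/measurable_EFinP.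
- exact: measurable_cst.
- by apply: aeW => x Dx; apply: cvg_EFin; [exact: nearW|exact: tail_width_cvg].
- apply: aeW => x M Dx; rewrite lee_fin ger0_norm ?tail0// lerD ?level_width_le1//.
  by case: ifP => // _; exact: f0.
by move=> _ _; rewrite integral0.
Qed.

(** The coefficients are the values of [simple_density] when [f] is the density of [PD]. At the cost
    of a factor 2, [integral_dist_average_le] replaces these averages by any constants, and well
    chosen ones are within [tail_width] of [f]. *)
Lemma level_average_cvg :
  (\int[nu]_(x in D) `|\sum_(i < M.+1)
      fine (\int[nu]_(x in level_set M i) (f x)%:E) / fine (nu (level_set M i))
      * \1_(level_set M i) x - f x|%:E)%E @[M --> \oo] --> 0%E.
Proof.
apply: (@squeeze_cvge _ _ _ _ (cst 0%E) _
  (fun M => 2%:E * \int[nu]_(x in D) (tail_width M x)%:E)%E).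
- apply: nearW => M; rewrite integral_ge0//=.
  rewrite integral_simple_dist; [|exact: measurable_level_set
    |exact: trivIset_level_set|exact: bigcup_level_set].
  (* The value 0 on the top cell makes the error there equal to [f], the tail that [tail_width]
     records. *)
  pose s (i : 'I_M.+1) := if (i < M)%N then i%:R * level_width M else 0.
  apply: (@le_trans _ _ (\sum_(i < M.+1)
      2%:E * \int[nu]_(x in level_set M i) `|f x - s i|%:E)%E).
    apply: lee_sum => i _; apply: integral_dist_average_le.
      exact: measurable_level_set.
    by move=> x [].
  rewrite -ge0_sume_distrr; last by move=> i _; apply: integral_ge0.
  rewrite lee_pmul2l//.
  have mtail x : D x -> (0 <= (tail_width M x)%:E)%E.
    move=> Dx; rewrite lee_fin addr_ge0// ?(ltW (level_width_gt0 M))//.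
    by case: ifP => // _; exact: f0.
  rewrite (bigcup_bigsetU _ _ (@bigcup_level_set M)) ge0_integral_bigsetU//=.
  + apply: lee_sum => i _; apply: ge0_le_integral.
    * exact: measurable_level_set.
    * by move=> x _; rewrite lee_fin.
    * apply/measurable_EFinP/measurableT_comp => //.
      by apply: measurable_funB => //; apply: measurable_funS mf => // x [].
    * by apply/measurable_EFinP; apply: measurable_funS (measurable_tail_width M) => // x [].
    * move=> x [Dx [ifx fxi]]; rewrite lee_fin /tail_width /s.
      case: (ltnP i M) fxi => [iM /(_ isT) fxi|Mi _].
        rewrite ger0_norm ?subr_ge0// lerBlDl addrA -[X in _ + X + _]mul1r -mulrDl natr1.
        by rewrite (le_trans (ltW fxi))// lerDl; case: ifP => // _; exact: f0.
      have iM : i = M :> nat by apply/eqP; rewrite eqn_leq Mi -ltnS ltn_ord.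
      move: ifx; rewrite subr0 ger0_norm ?f0// iM => ->; rewrite lerDr.
      exact/ltW/level_width_gt0.
  + exact: measurable_level_set.
  + exact: index_enum_uniq.
  + exact: sub_trivIset (@trivIset_level_set M).
  + by rewrite -(bigcup_bigsetU _ _ (@bigcup_level_set M)); exact/measurable_EFinP.
  + by rewrite -(bigcup_bigsetU _ _ (@bigcup_level_set M)).
- exact: cvg_cst.
- by rewrite -[X in cvg_to _ (nbhs X)](mule0 2%:E); apply: cvgeZl.
Qed.
End level_partition.

(** * Finite unions of sets that overlap in null sets *)

Section almost_disjoint_union.
Local Open Scope ereal_scope.
Context {d} {T : measurableType d} {R : realType}.
Variable mu : {measure set T -> \bar R}.

(** By induction: since [s] has no repetition, the head meets the union of the tail in a finite
    union of null sets. Voronoi cells share boundary points, so plain additivity does not apply to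
    them. *)
Lemma measure_bigsetU_ae_disjoint {J : eqType} (B : J -> set T) (s : seq J) :
  uniq s -> (forall j, measurable (B j)) ->
  (forall i j, i != j -> mu (B i `&` B j) = 0) ->
  mu (\big[setU/set0]_(j <- s) B j) = \sum_(j <- s) mu (B j).
Proof.
move=> + mB dB; elim: s => [|j s IH /= /andP[js us]].
  by rewrite !big_nil measure0.
rewrite !big_cons -IH//; set W := \big[setU/set0]_(_ <- _) _.
have mW : measurable W by exact: bigsetU_measurable.
have W0 : mu (W `&` B j) = 0.
  rewrite /W big_distrl/= big_seq.
  (* Measurability is carried along because [measureU0] asks for it at each union. *)
  pose null C := measurable C /\ mu C = 0.
  suff [] : null (\big[setU/set0]_(i <- s | i \in s) (B i `&` B j)) by [].
  apply: big_ind => [|C C' [mC C0] [mC' C'0]|i iS].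
  - by split; [exact: measurable0|exact: measure0].
  - by split; [exact: measurableU|rewrite measureU0].
  - split; first exact: measurableI.
    by apply: dB; apply: contraNneq js => <-.
have -> : mu W = mu (W `\` B j).
  rewrite (measureDI mu mW (mB j)).
 by rewrite [X in _ + X](_ : _ = 0) ?adde0.
rewrite (measureDI mu (measurableU _ _ (mB j) mW) (mB j)) setUK setDUl.
by rewrite setDv set0U addeC.
Qed.
End almost_disjoint_union.

(** * Borel sets of the space of row vectors and of its subsets *)

Section borel.
Context {R : realType}.

Lemma borel_open k (U : set 'rV[R]_k) :
  open U -> measurable (U : set (borelRV R k)).
Proof. by move=> oU; exact: sub_sigma_algebra. Qed.

Lemma borel_compact k (K : set 'rV[R]_k) :
  compact K -> measurable (K : set (borelRV R k)).
Proof.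
move=> cK; rewrite -(setCK K); apply: measurableC; apply: borel_open.
apply: closed_openC; apply: compact_closed => //.
Qed.

Lemma measurable_borel_on k (S E : set 'rV[R]_k) :
  measurable (S : set (borelRV R k)) -> borel_on S E ->
  measurable (E : set (borelRV R k)).
Proof. by move=> mS [F mF <-]; exact: measurableI. Qed.

Lemma borel_on_measurable k (S E : set 'rV[R]_k) :
  measurable (E : set (borelRV R k)) -> E `<=` S -> borel_on S E.
Proof. by move=> mE ES; exists E => //; exact/setIidl. Qed.

Lemma borel_on_sub k (S E : set 'rV[R]_k) : borel_on S E -> E `<=` S.
Proof. by move=> [F _ <-]; exact: subIsetr. Qed.

End borel.

(** * Continuity and measurability of [Q] on [L] *)

Section regularity.
Context {R : realType} {n m : nat}.
Variables (L : set 'rV[R]_n) (Q : 'rV[R]_n -> 'rV[R]_m).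
Hypothesis regularQ : locally_differentiable_full_rank L Q.

(** Near a point of [L], [Q] agrees on [L] with a differentiable, hence continuous, map. *)
Lemma regular_within_continuous : {within L, continuous Q}.
Proof.
apply/subspace_continuousP => x Lx.
have [U [g [oU Ux gQ dg _]]] := regularQ x Lx.
suff : Q @ within L (nbhs x) --> g x by rewrite (gQ x Ux Lx).
apply: (@cvg_trans _ (g @ within L (nbhs x))).
  apply: near_eq_cvg; near=> y; apply: gQ.
    by near: y; apply: cvg_within; exact: open_nbhs_nbhs.
  by near: y; exact: withinT.
by apply: cvg_within_filter; exact: differentiable_continuous (dg x Ux).
Unshelve. all: by end_near. Qed.

Lemma compact_outputs : compact L -> compact (outputs L Q).
Proof. by apply: continuous_compact; exact: regular_within_continuous. Qed.

Lemma regular_measurable : compact L ->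
  measurable_fun (L : set (borelRV R n)) (Q : borelRV R n -> borelRV R m).
Proof.
move=> cL; apply: measurability => [|_ [V oV <-]]; first by [].
have /continuousP/(_ V oV)/open_subspaceP[W oW WV] := regular_within_continuous.
rewrite setIC -WV; apply: measurableI; [exact: borel_open|exact: borel_compact].
Qed.

End regularity.

(** * Measurability and covering by Voronoi cells *)

Section voronoi_cells.
Context {R : realType} {n : nat}.
Variables (L : set 'rV[R]_n) (dv : 'rV[R]_n -> 'rV[R]_n -> R).
Hypothesis mL : measurable (L : set (borelRV R n)).
Hypothesis metric_dv : is_borel_metric_on L dv.
Context {N : nat}.
Variable lam : 'I_N -> 'rV[R]_n.
Hypothesis lamL : forall j, L (lam j).

Lemma measurable_voronoi j :
  measurable (voronoi L dv lam j : set (borelRV R n)).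
Proof.
have [_ _ _ _ mdv] := metric_dv.
(* Each comparison is intersected with [L] because the distance functions are measurable on [L]. *)
have -> : voronoi L dv lam j =
    L `&` \big[setI/setT]_i (L `&` [set x | dv (lam j) x <= dv (lam i) x]).
  rewrite -bigcap_seq; apply/seteqP; split=> [x [Lx jx]|x [Lx jx]]; split=> //.
    by move=> i _; split => /=.
  by move=> i; have [] := jx i (mem_index_enum i).
apply: measurableI => //; apply: bigsetI_measurable => i _.
by apply: measurable_fun_le => //; exact: mdv.
Qed.

Lemma bigcup_voronoi : (0 < N)%N -> \bigcup_j voronoi L dv lam j = L.
Proof.
move=> N0; apply/seteqP; split=> [x [j _ []]//|x Lx].
have [j _ jmin] := arg_minP (fun j => dv (lam j) x) (isT : xpredT (Ordinal N0)).
by exists j => //; split => // i; exact: jmin.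
Qed.

Lemma voronoi_coverageE E : voronoi_coverage L dv lam E =
  \big[setU/set0]_(j <- [seq j <- index_enum 'I_N | lam j \in E])
    voronoi L dv lam j.
Proof.
rewrite -bigcup_seq; apply: eq_bigcup => //; split=> j /=.
  by move=> Ej; rewrite mem_filter mem_index_enum andbT inE.
by rewrite mem_filter => /andP[]; rewrite inE.
Qed.

Lemma measurable_voronoi_coverage E :
  measurable (voronoi_coverage L dv lam E : set (borelRV R n)).
Proof.
rewrite voronoi_coverageE; apply: bigsetU_measurable => j _.
exact: measurable_voronoi.
Qed.

Lemma voronoi_coverage_sub E : voronoi_coverage L dv lam E `<=` L.
Proof. by move=> x [j _ []]. Qed.

End voronoi_cells.

(** * The counting measure as an integral over the Voronoi coverage *)

Section counting_integral.
Context {R : realType} {n m : nat}.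
Variables (L : set 'rV[R]_n) (Q : 'rV[R]_n -> 'rV[R]_m).
Variables (mu : {measure set (borelRV R n) -> \bar R}) (PD : set (borelRV R m) -> \bar R).
Variable dv : 'rV[R]_n -> 'rV[R]_n -> R.
Hypothesis mL : measurable (L : set (borelRV R n)).
Hypothesis mQ :
  measurable_fun (L : set (borelRV R n)) (Q : borelRV R n -> borelRV R m).
Hypothesis finite_mu : (mu L < +oo)%E.
Hypothesis metric_dv : is_borel_metric_on L dv.
Hypothesis PD_ge0 : forall F, (0 <= PD F)%E.
Context {M N : nat}.
Variables (I : 'I_M -> set 'rV[R]_m) (lam : 'I_N -> 'rV[R]_n).
Hypothesis mI : forall i, measurable (I i : set (borelRV R m)).
Hypothesis lamL : forall j, L (lam j).
Hypothesis tessellation : is_voronoi_tessellation L dv lam mu.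
Hypothesis N_gt0 : (0 < N)%N.

Let mV := measurable_voronoi L dv mL metric_dv lam lamL.

Let mpre i : measurable (preimageQ L Q (I i) : set (borelRV R n)).
Proof. exact: mQ. Qed.

Let volumeE i j : (cell_volume L Q mu I dv lam i j)%:E =
  mu (preimageQ L Q (I i) `&` voronoi L dv lam j).
Proof.
rewrite /cell_volume fineK// ge0_fin_numE//.
apply: le_lt_trans finite_mu; apply: le_measure; rewrite ?inE//.
  exact: measurableI.
by move=> x [[]].
Qed.

(** The tessellation hypothesis makes the overlaps of cells null, so their volumes add up. *)
Lemma measure_voronoi_coverage i (E : set 'rV[R]_n) :
  mu (preimageQ L Q (I i) `&` voronoi_coverage L dv lam E) =
  (\sum_(j | lam j \in E) cell_volume L Q mu I dv lam i j)%:E.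
Proof.
rewrite voronoi_coverageE big_distrr/= measure_bigsetU_ae_disjoint.
- by rewrite big_filter -sumEFin; apply: eq_bigr => j _; rewrite volumeE.
- by rewrite filter_uniq// index_enum_uniq.
- by move=> j; exact: measurableI.
- move=> j k jk; apply: subset_measure0 (tessellation _ _ jk) => //.
  + by apply: measurableI; exact: measurableI.
  + exact: measurableI.
  + by move=> x [[_ ?] [_ ?]].
Qed.

(** All samples lie in [L] and [N > 0], so the coverage of [L] is [L]. The denominators in
    [cell_probability] are thus the volumes of the cells [I i]. *)
Let sum_volume i : \sum_k cell_volume L Q mu I dv lam i k =
  fine (push_volume L Q mu (I i)).
Proof.
have := measure_voronoi_coverage i L.
under eq_bigl do rewrite mem_set//.
move=> /(congr1 fine)/= <-; congr (fine (mu _)).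
rewrite (_ : voronoi_coverage L dv lam L = L).
  by apply/setIidl => x [].
rewrite -[RHS](bigcup_voronoi L dv lam N_gt0).
by apply: eq_bigcup => //; split=> j //= _; exact: lamL.
Qed.

Lemma measurable_simple_density (nu : set (borelRV R m) -> \bar R) :
  measurable_fun setT (simple_density nu PD I : borelRV R m -> R).
Proof. by apply: measurable_sum => i; apply: measurable_funM. Qed.

Lemma simple_density_ge0 (nu : set (borelRV R m) -> \bar R) q :
  (forall F, (0 <= nu F)%E) -> 0 <= simple_density nu PD I q.
Proof.
by move=> nu0; apply: sumr_ge0 => i _; rewrite mulr_ge0// divr_ge0// fine_ge0.
Qed.

(** After exchanging the sums over [i] and [j], the cell [I i] contributes its density value times
    the volume of its preimage inside the coverage, which is the integral of one term of the simple
    density. *)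
Lemma counting_measureE (E : set 'rV[R]_n) :
  (counting_measure L Q mu PD I dv lam E)%:E =
  (\int[mu]_(x in voronoi_coverage L dv lam E)
     (simple_density (push_volume L Q mu) PD I (Q x))%:E)%E.
Proof.
set W := voronoi_coverage _ _ _ _.
have mW : measurable (W : set (borelRV R n)) by exact: measurable_voronoi_coverage.
pose c i := fine (PD (I i)) / fine (push_volume L Q mu (I i)).
have c0 i : 0 <= c i by rewrite divr_ge0// fine_ge0.
transitivity (\sum_i \int[mu]_(x in W) ((c i)%:E * (\1_(preimageQ L Q (I i)) x)%:E))%E.
  rewrite /counting_measure /cell_probability exchange_big/= -sumEFin.
  apply: eq_bigr => i _; rewrite ge0_integralZl_EFin//; last first.
    by apply/measurable_EFinP; exact: measurable_indic.
  rewrite integral_indic// measure_voronoi_coverage -EFinM mulr_sumr.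
  (* [p * (v / V) = p / V * v] holds for [V = 0] too, so null cells need no separate case. *)
  by congr EFin; apply: eq_bigr => j _; rewrite sum_volume /c mulrAC mulrA.
rewrite -ge0_integral_sum//.
- apply: eq_integral => x; rewrite inE => -[j _ [Lx _]].
  rewrite -sumEFin; apply: eq_bigr => i _; rewrite EFinM; congr (_ * (_ : R)%:E)%E.
  rewrite !indicE; congr ((nat_of_bool _)%:R).
  by apply/idP/idP; rewrite !inE => // -[].
- by move=> i; apply: measurable_funeM; apply/measurable_EFinP; exact: measurable_indic.
- by move=> i x _; rewrite -EFinM lee_fin mulr_ge0.
Qed.

End counting_integral.

(** * Absolute continuity of the integral *)

Section absolute_continuity.
Context {d} {T : measurableType d} {R : realType}.
Variable mu : {measure set T -> \bar R}.

(** Extending [f] by 0 outside [D] reduces this to the property on the whole space. *)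
Lemma ge0_integral_absolutely_continuous (D : set T) (f : T -> R) (e : R) :
  measurable D -> mu.-integrable D (EFin \o f) ->
  (forall x, D x -> 0 <= f x) -> 0 < e ->
  exists2 r : R, 0 < r & forall A, measurable A -> A `<=` D ->
    (mu A < r%:E)%E -> (\int[mu]_(x in A) (f x)%:E < e%:E)%E.
Proof.
move=> mD intf f0 e0; pose g := f \_ D.
have intg : mu.-integrable setT (EFin \o g).
  have := integrable_mkcond (EFin \o f) mD; rewrite restrict_EFin => <-.
  exact: intf.
have [r [r0 rP]] := integral_normr_continuous intg e0.
exists r => // A mA AD /(rP A mA).
rewrite -lte_fin /Rintegral.
have intA : mu.-integrable A (EFin \o f) by exact: integrableS intf.
have -> : (\int[mu]_(x in A) `|g x|%:E = \int[mu]_(x in A) (f x)%:E)%E.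
  apply: eq_integral => x /[!inE] Ax.
  by rewrite /g patchE mem_set ?ger0_norm ?f0//; exact: AD.
by rewrite fineK//; exact: integrable_fin_num.
Qed.

End absolute_continuity.

(** * Measurability of inversion, for the normalization in the Ansatz *)

Section measurable_inverse.
Context {R : realType}.

(** Inversion is continuous on the open set of nonzero reals, and the remaining point is a
    measurable singleton. *)
Lemma measurable_invr : measurable_fun [set: R] (@GRing.inv R).
Proof.
have -> : [set: R] = [set x : R | x != 0] `|` [set 0].
  apply/seteqP; split=> // x _ /=.
  by have [->|x0] := eqVneq x 0; [right|left].
have o0 : open [set x : R | x != 0] by exact: open_neq.
apply/measurable_funU => //; first exact: open_measurable.
split; last exact: measurable_fun_set1.
apply: open_continuous_measurable_fun => // x; rewrite inE => x0.
exact: inv_continuous.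
Qed.

Lemma measurable_inve : measurable_fun [set: \bar R] (@inve R).
Proof.
(* At [+oo] the last branch gives 0, since [fine] sends [+oo] to 0 and the inverse of 0 in [R] is
   0. *)
have -> : @inve R = fun x => if x == 0%E then +oo%E else
    if x == -oo%E then -oo%E else ((fine x)^-1)%:E.
  apply/funext => x; case: inveP => [|||r r0] /=.
  - by rewrite eqxx.
  - by rewrite invr0.
  - by [].
  - by rewrite eqe (negbTE r0).
apply: measurable_fun_ifT => //.
  exact: measurable_fun_eqe.
apply: measurable_fun_ifT => //.
  exact: measurable_fun_eqe.
apply/measurable_EFinP; apply: measurableT_comp; first exact: measurable_invr.
exact: fine_measurable.
Qed.

Lemma inve_ge0 (x : \bar R) : (0 <= x -> 0 <= x^-1)%E.
Proof.
case: inveP => [|||r r0]//; rewrite ?lee_fin ?invr_ge0//.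
Qed.

End measurable_inverse.

(** * Disintegration along the contours, and the density of the inverse measure *)

Section disintegration.
Context {R : realType} {n m : nat}.
Variables (L : set 'rV[R]_n) (Q : 'rV[R]_n -> 'rV[R]_m).
Variable mu : {measure set (borelRV R n) -> \bar R}.
Hypothesis mL : measurable (L : set (borelRV R n)).
Hypothesis mQ :
  measurable_fun (L : set (borelRV R n)) (Q : borelRV R n -> borelRV R m).
Hypothesis mD : measurable (outputs L Q : set (borelRV R m)).

Local Notation fiber := (contour_of_output L Q).
Local Notation fiberb := (fiber : borelRV R m -> contourType L Q).
Local Notation Qb := (Q : borelRV R n -> borelRV R m).

Lemma contour_of_output_inj q q' :
  outputs L Q q -> fiber q = fiber q' -> q = q'.
Proof.
move=> [x Lx <-] /seteqP[+ _] => /(_ x) [] //.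
Qed.

Lemma contour_projE x : contour_proj L Q x = fiber (Q x).
Proof. by []. Qed.

Lemma contour_set_fiber q : outputs L Q q -> contour_set L Q (fiber q) = fiber q.
Proof.
move=> Dq; apply/seteqP; split=> x [Lx].
  by move=> /(contour_of_output_inj (Q x) q (imageP Q Lx)) Qx; split.
by move=> Qxq; split => //; rewrite /= contour_projE Qxq.
Qed.

Lemma measurable_contour_of_output :
  measurable_fun (outputs L Q : set (borelRV R m))
    fiberb.
Proof. by apply: measurability => [|_ [B mB <-]]; first by []. Qed.

Lemma measurable_contours : measurable (contours L Q : set (contourType L Q)).
Proof.
apply: sub_sigma_algebra; rewrite /image_set_system/=.
rewrite (_ : _ `&` _ = outputs L Q)//; apply/setIidl => _ [x Lx <-].
by exists x.
Qed.

(* The image [contour_proj L Q @` E] need not be measurable, but the integrand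
   vanishes outside it. *)
Lemma integral_transport (nu : {measure set (borelRV R m) -> \bar R})
    (E : set 'rV[R]_n) (phi : contourType L Q -> \bar R) :
  E `<=` L -> measurable_fun (contours L Q : set (contourType L Q)) phi ->
  (forall l, 0 <= phi l)%E ->
  (forall l, ~ (contour_proj L Q @` E) l -> phi l = 0%E) ->
  (\int[@transport R n m L Q nu]_(l in contour_proj L Q @` E) phi l =
   \int[nu]_(q in outputs L Q) phi (fiber q))%E.
Proof.
move=> EL mphi phi0 phiE.
have phi_out A : contour_proj L Q @` E `<=` A -> phi \_ A = phi.
  move=> EA; apply/funext => l; rewrite patchE; case: ifPn => // /negP lA.
  by rewrite phiE// => /EA lA'; apply: lA; rewrite inE.
pose tr := image_measure_of nu (outputs L Q)
  fiberb mD measurable_contour_of_output.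
transitivity (\int[tr]_(l in contour_proj L Q @` E) phi l)%E; first by [].
transitivity (\int[tr]_l phi l)%E.
  rewrite integral_mkcond; apply: eq_integral => l _.
  exact: (congr1 (fun g => g l) (phi_out _ (@subset_refl _ _))).
have mphiT : measurable_fun setT phi.
  rewrite -(phi_out (contours L Q)); last by move=> _ [x Ex <-]; exists x => //; exact: EL.
  by apply/(measurable_restrictT _ measurable_contours).
exact: (ge0_integral_image_measure nu (outputs L Q)
  fiberb mD measurable_contour_of_output).
Qed.

Variable muC : contourType L Q -> {measure set (borelRV R n) -> \bar R}.
Hypothesis disint : is_disintegration mu muC.

(** The contour measures read on the output space, where [q] labels its contour. *)
Definition fiber_mass (E : set 'rV[R]_n) (q : borelRV R m) : \bar R :=
  muC (fiber q) (fiber q `&` E).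

Lemma fiber_mass_ge0 E q : (0 <= fiber_mass E q)%E.
Proof. exact: measure_ge0. Qed.

Lemma fiber_massE E q : outputs L Q q ->
  muC (fiber q) (contour_set L Q (fiber q) `&` E) = fiber_mass E q.
Proof. by move=> Dq; rewrite contour_set_fiber. Qed.

Lemma contour_mass_out E l : ~ (contour_proj L Q @` E) l ->
  muC l (contour_set L Q l `&` E) = 0%E.
Proof.
move=> El; rewrite (_ : _ `&` _ = set0) ?measure0//.
by apply/seteqP; split=> // x [[Lx xl] Ex]; apply: El; exists x.
Qed.

Lemma measurable_fiber_mass E : borel_on L E ->
  measurable_fun (outputs L Q : set (borelRV R m)) (fiber_mass E).
Proof.
move=> bE; have [mE _] := disint _ bE.
have := measurable_comp measurable_contours _ mE measurable_contour_of_output.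
have sub : fiber @` outputs L Q `<=` contours L Q.
  by move=> _ [_ [x Lx <-] <-]; exists x.
move=> /(_ sub); apply: eq_measurable_fun => q /[!inE] Dq /=.
exact: fiber_massE.
Qed.

Let muD := image_measure_of mu L Qb mL mQ.

(** A contour over [F] meets the preimage part of [E] exactly as it meets [E], and any other contour
    misses it. Hence [fiber_mass E] is the density, with respect to [muD], of the image under [Q] of
    [mu] restricted to [E]. *)
Lemma integral_fiber_mass E (F : set (borelRV R m)) :
  borel_on L E -> measurable F ->
  (mu (E `&` Q @^-1` F) =
   \int[push_volume L Q mu]_(q in outputs L Q `&` F) fiber_mass E q)%E.
Proof.
move=> bE mF; pose E' := E `&` Q @^-1` F.
have EL := borel_on_sub _ _ _ bE.
have bE' : borel_on L E'.
  apply: borel_on_measurable; last by move=> x [/EL].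
  rewrite /E' -(setIidl EL) -setIA; apply: measurableI.
    exact: measurable_borel_on bE.
  exact: mQ.
have [mE' ->] := disint _ bE'.
rewrite (integral_transport muD E')//; last exact: contour_mass_out.
- rewrite -[RHS]/(\int[muD]_(q in outputs L Q `&` F) fiber_mass E q)%E.
  rewrite integral_mkcondr; apply: eq_integral => q /[!inE] Dq.
  rewrite fiber_massE// patchE; case: ifPn => [|/negP] qF.
    congr (muC _ _); apply/seteqP; split=> x [[Lx Qx]].
      by move=> [Ex _].
    by move=> Ex; split => //; split => //; rewrite /= Qx -inE.
  rewrite /fiber_mass (_ : _ `&` _ = set0) ?measure0//.
  apply/seteqP; split=> // x [[Lx Qx] [_ Fx]]; apply: qF.
  by rewrite inE -Qx.
- exact: borel_on_sub bE'.
Qed.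

Hypothesis finite_mu : (mu L < +oo)%E.

(** For [E = L] the previous identity gives both functions the integral [muD F] over every
    measurable [F] inside the outputs. Finiteness of [mu L] makes the constant integrable. *)
Lemma fiber_mass_full : ae_eq muD (outputs L Q) (cst 1%E) (fiber_mass L).
Proof.
have bL : borel_on L L by exact: borel_on_measurable.
apply: integral_ae_eq => //.
- apply/integrableP; split; first exact: measurable_cst.
  suff : (\int[muD]_(q in outputs L Q) cst `|1%E : \bar R| q < +oo)%E by [].
  rewrite integral_cst// lte_mul_pinfty//.
  by apply: le_lt_trans finite_mu; apply: le_measure; rewrite ?inE//; exact: mQ.
- exact: measurable_fiber_mass.
- move=> F FD mF; suff -> : (\int[muD]_(q in F) cst 1 q = muD F)%E.
    rewrite -[RHS]/(\int[push_volume L Q mu]_(q in F) fiber_mass L q)%E.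
    by rewrite -{2}(setIidr FD) -integral_fiber_mass.
  by rewrite integral_cst// mul1e.
Qed.

Variable PD : {measure set (borelRV R m) -> \bar R}.
Hypothesis PD_ac : PD `<< push_volume L Q mu.

(** The Ansatz divides by a contour mass that equals 1 for [muD]-almost every output, hence for
    [PD]-almost every one by [PD_ac]. *)
Lemma inverse_measure_fiber_mass (A : set 'rV[R]_n) : borel_on L A ->
  (inverse_measure muC PD A = \int[PD]_(q in outputs L Q) fiber_mass A q)%E.
Proof.
move=> bA; have [mA _] := disint _ bA.
have bL : borel_on L L by exact: borel_on_measurable.
have [mLL _] := disint _ bL.
have contour_setL l : contour_set L Q l `&` L = contour_set L Q l.
  by apply/setIidl => x [].
pose phi (l : contourType L Q) :=
  ansatz muC l (contour_set L Q l `&` A).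
have mphi : measurable_fun (contours L Q : set (contourType L Q)) phi.
  apply: emeasurable_funM => //.
  apply: (measurableT_comp measurable_inve).
  by apply: eq_measurable_fun mLL => l _; rewrite contour_setL.
rewrite /inverse_measure (integral_transport PD A phi)//; last 3 first.
- exact: borel_on_sub bA.
- by move=> l; rewrite mule_ge0// inve_ge0.
- by move=> l Al; rewrite /phi /ansatz contour_mass_out// mul0e.
have phiE q : outputs L Q q ->
    phi (fiber q) = (fiber_mass A q * (fiber_mass L q)^-1)%E.
  move=> Dq; rewrite /phi /ansatz /fiber_mass contour_set_fiber//.
  by rewrite [fiber q `&` L]setIidl// => x [].
have mfA := measurable_fiber_mass A bA.
have mfL := measurable_fiber_mass L bL.
under eq_integral => q /[!inE] Dq do rewrite phiE//.
apply: ge0_ae_eq_integral => //.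
- apply: emeasurable_funM => //; exact: (measurableT_comp measurable_inve).
- by move=> q _; rewrite mule_ge0 ?inve_ge0 ?fiber_mass_ge0.
- have : ae_eq PD (outputs L Q) (cst 1%E) (fiber_mass L).
    exact: null_dominates_ae_eq fiber_mass_full.
  apply: filterS => q /[swap] Dq /(_ Dq) <-.
  by rewrite inver oner_eq0 invr1 mule1.
Qed.

Variable rho : borelRV R m -> R.
Hypothesis mrho : measurable_fun (outputs L Q : set (borelRV R m)) rho.
Hypothesis rho0 : forall q, outputs L Q q -> 0 <= rho q.
Hypothesis rho_density : forall F : set (borelRV R m), measurable F -> F `<=` outputs L Q ->
  PD F = (\int[push_volume L Q mu]_(q in F) (rho q)%:E)%E.
Hypothesis PD_outputs : PD (~` outputs L Q) = 0%E.

(** With respect to [muD], [PD] has density [rho] and the image under [Q] of [mu] restricted to [A]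
    has density [fiber_mass A]. Integrating either density against the other measure gives the
    integral of their product, so both sides agree. *)
Lemma inverse_measureE (A : set 'rV[R]_n) : borel_on L A ->
  (inverse_measure muC PD A = \int[mu]_(x in A) (rho (Q x))%:E)%E.
Proof.
move=> bA; rewrite inverse_measure_fiber_mass//.
have AL := borel_on_sub _ _ _ bA.
have mA : measurable (A : set (borelRV R n)) by exact: measurable_borel_on bA.
have mQA : measurable_fun (A : set (borelRV R n)) Qb by exact: measurable_funS mQ.
(* The change of variables takes functions measurable on the whole space, hence the extensions by
   0. *)
pose r : borelRV R m -> \bar R := (EFin \o rho) \_ (outputs L Q).
have mr : measurable_fun setT r.
  by apply/(measurable_restrictT _ mD)/measurable_EFinP.
have r0 q : (0 <= r q)%E.
  by rewrite /r patchE; case: ifPn => // /[!inE] Dq; rewrite lee_fin rho0.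
have rQ x : A x -> r (Q x) = (rho (Q x))%:E.
  by move=> /AL Lx; rewrite /r patchE mem_set//; exists x.
pose G : borelRV R m -> \bar R := fiber_mass A \_ (outputs L Q).
have mfA := measurable_fiber_mass A bA.
have mG : measurable_fun setT G by apply/(measurable_restrictT _ mD).
have G0 q : (0 <= G q)%E.
  by rewrite /G patchE; case: ifPn => // _; exact: fiber_mass_ge0.
have -> : (\int[PD]_(q in outputs L Q) fiber_mass A q = \int[PD]_q G q)%E.
  by rewrite integral_mkcond.
have mid : measurable_fun (outputs L Q : set (borelRV R m)) (@idfun (borelRV R m)).
  exact: measurable_id.
(* [F] may leave the outputs; the part outside is null by [PD_outputs]. *)
have PDE F : measurable F -> PD F =
    (\int[muD]_(q in outputs L Q `&` idfun @^-1` F) (rho q)%:E)%E.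
  move=> mF; rewrite (measureDI PD mF mD) [X in (X + _)%E](_ : _ = 0%E); last first.
    apply: subset_measure0 PD_outputs; [exact: measurableD|exact: measurableC|].
    by move=> q [].
  rewrite add0e setIC; apply: rho_density; first exact: measurableI.
  exact: subIsetl.
have mrhoE : measurable_fun (outputs L Q : set (borelRV R m)) (EFin \o rho).
  exact/measurable_EFinP.
have rhoE0 q : outputs L Q q -> (0 <= (EFin \o rho) q)%E.
  by move=> Dq; rewrite lee_fin rho0.
(* With [idfun] as the map, the formula only changes the density. *)
rewrite (ge0_integral_image_density muD PD (outputs L Q) idfun
  (EFin \o rho) mD mid mrhoE rhoE0 PDE G mG G0).
pose kappa := image_measure_of mu A Qb mA mQA.
have kappaE F : measurable F -> kappa F =
    (\int[muD]_(q in outputs L Q `&` idfun @^-1` F) fiber_mass A q)%E.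
  by move=> mF; exact: integral_fiber_mass.
have <- : (\int[kappa]_q r q = \int[mu]_(x in A) (rho (Q x))%:E)%E.
  rewrite (ge0_integral_image_measure mu A Qb mA mQA)//.
  by apply: eq_integral => x /[!inE] /rQ.
rewrite (ge0_integral_image_density muD kappa (outputs L Q) idfun
  (fiber_mass A) mD mid mfA (fun q _ => fiber_mass_ge0 A q) kappaE r mr r0).
by apply: eq_integral => q Dq; rewrite /G /r !patchE Dq muleC.
Qed.

End disintegration.

Lemma lt_dist_EFin (R : realType) (a b e : R) (x : \bar R) :
  (x < e%:E)%E -> (a%:E <= b%:E + x)%E -> (b%:E <= a%:E + x)%E -> `|b - a| < e.
Proof.
case: x => [x||]//; rewrite lte_fin -!EFinD !lee_fin => xe ab ba.
rewrite (le_lt_trans _ xe)// ler_norml; apply/andP; split.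
  by rewrite lerBrDl lerBlDr.
by rewrite lerBlDl.
Qed.

(** * Comparison of integrals of two functions over two sets *)

Section integral_symmetric_difference.
Local Open Scope ereal_scope.
Context {d} {T : measurableType d} {R : realType}.
Variable mu : {measure set T -> \bar R}.

Lemma measurable_setY (A B : set T) :
  measurable A -> measurable B -> measurable (A `+` B).
Proof. by move=> mA mB; apply: measurableU; exact: measurableD. Qed.

(** [B] lies in the union of [A] and the difference of [B] and [A], which is part of the symmetric
    difference. *)
Lemma ge0_integral_setY_le (D A B : set T) (f : T -> \bar R) :
  measurable A -> measurable B -> A `<=` D -> B `<=` D ->
  measurable_fun D f -> (forall x, D x -> 0 <= f x) -> measurable D ->
  \int[mu]_(x in B) f x <= \int[mu]_(x in A) f x + \int[mu]_(x in A `+` B) f x.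
Proof.
move=> mA mB AD BD mf f0 mD.
have mBA : measurable (B `\` A) by exact: measurableD.
have UD : A `|` (B `\` A) `<=` D by move=> x [/AD|[/BD]].
have YD : A `+` B `<=` D by move=> x [[/AD]|[/BD]].
apply: (@le_trans _ _ (\int[mu]_(x in A `|` (B `\` A)) f x)).
  apply: ge0_subset_integral => //.
  - exact: measurableU.
  - exact: measurable_funS mf.
  - by move=> x /UD; exact: f0.
  - by move=> x Bx; have [Ax|Ax] := pselect (A x); [left|right].
rewrite ge0_integral_setU//; last 3 first.
- exact: measurable_funS mf.
- by move=> x /UD; exact: f0.
- by apply/disj_setPS => x [Ax []].
rewrite leeD2l//; apply: ge0_subset_integral => //.
- exact: measurable_setY.
- exact: measurable_funS mf.
- by move=> x /YD; exact: f0.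
- by move=> x BAx; right.
Qed.

(** The function is changed on the fixed set [W] and the set is changed under the fixed [f]. So if
    [g] depends on [M] and [W] on [N], each error term depends on one index. One-sided sums avoid
    subtracting possibly infinite integrals. *)
Lemma ge0_le_integral_dist (D A W : set T) (f g : T -> R) :
  measurable D -> measurable A -> measurable W -> A `<=` D -> W `<=` D ->
  measurable_fun D f -> measurable_fun D g ->
  (forall x, D x -> (0 <= f x)%R) -> (forall x, D x -> (0 <= g x)%R) ->
  let error := \int[mu]_(x in D) `|g x - f x|%:E +
               \int[mu]_(x in A `+` W) (f x)%:E in
  \int[mu]_(x in W) (g x)%:E <= \int[mu]_(x in A) (f x)%:E + error /\
  \int[mu]_(x in A) (f x)%:E <= \int[mu]_(x in W) (g x)%:E + error.
Proof.
move=> mD mA mW AD WD mf mg f0 g0 error.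
have mfe : measurable_fun D (EFin \o f) by exact/measurable_EFinP.
have mdist : measurable_fun D (fun x => `|g x - f x|%:E).
  by apply/measurable_EFinP/measurableT_comp => //; exact: measurable_funB.
have dist_le : \int[mu]_(x in W) `|g x - f x|%:E <= \int[mu]_(x in D) `|g x - f x|%:E.
  by apply: ge0_subset_integral => // x _; rewrite lee_fin.
(* Applied to [g], [f] and to [f], [g], hence the symmetric hypothesis on the distances. *)
have le_W (h k : T -> R) : measurable_fun D h -> measurable_fun D k ->
    (forall x, D x -> (0 <= h x)%R) -> (forall x, D x -> (0 <= k x)%R) ->
    (forall x, `|k x - h x| = `|g x - f x|)%R ->
    \int[mu]_(x in W) (h x)%:E <=
    \int[mu]_(x in W) (k x)%:E + \int[mu]_(x in D) `|g x - f x|%:E.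
  move=> mh mk h0 k0 kh; apply: le_trans (leeD2l _ dist_le).
  have mkW : measurable_fun W (EFin \o k).
    by apply/measurable_EFinP; exact: measurable_funS mk.
  have mdW : measurable_fun W (fun x => `|g x - f x|%:E).
    exact: measurable_funS mdist.
  rewrite -ge0_integralD//; last first.
    by move=> x /WD Dx; rewrite lee_fin k0.
  apply: ge0_le_integral => //.
  - by move=> x /WD Dx; rewrite lee_fin h0.
  - by apply/measurable_EFinP; exact: measurable_funS mh.
  - exact: emeasurable_funD.
  - move=> x _; rewrite -EFinD lee_fin -kh -lerBlDl.
    by rewrite (le_trans (ler_norm _))// distrC.
have f0e x : D x -> 0 <= (EFin \o f) x by move=> Dx; rewrite lee_fin f0.
split.
- apply: (le_trans (le_W g f mg mf g0 f0 _)); first by move=> x; rewrite distrC.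
  rewrite /error [X in _ <= _ + X]addeC addeA leeD2r//.
  exact: (ge0_integral_setY_le D A W (EFin \o f)).
- apply: (le_trans (ge0_integral_setY_le D W A (EFin \o f) mW mA WD AD mfe f0e mD)).
  rewrite setYC /error addeA leeD2r//.
  exact: le_W.
Qed.

End integral_symmetric_difference.

(** * Joint convergence of the counting measures *)

Theorem theorem4p1 (R : realType) (n m : nat) (le_mn : (m <= n)%N)
    (L : set 'rV[R]_n) (compactL : compact L)
    (mu : {measure set (borelRV R n) -> \bar R})
    (lebesgue_mu : is_lebesgue mu) (finite_mu : (mu L < +oo)%E)
    (Q : 'rV[R]_n -> 'rV[R]_m)
    (regularQ : locally_differentiable_full_rank L Q)
    (muC : contourType L Q -> {measure set (borelRV R n) -> \bar R})
    (disintegration : is_disintegration mu muC)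
    (PD : probability (borelRV R m) R) (PD_outputs : PD (outputs L Q) = 1%E)
    (PD_ac : PD `<< push_volume L Q mu)
    (rhoD : borelRV R m -> R)
    (measurable_rhoD : measurable_fun (outputs L Q : set (borelRV R m)) rhoD)
    (rhoD_ge0 : forall q, outputs L Q q -> 0 <= rhoD q)
    (rhoD_density : forall F, borel_on (outputs L Q) F ->
      PD F = (\int[push_volume L Q mu]_(q in F) (rhoD q)%:E)%E)
    (dv : 'rV[R]_n -> 'rV[R]_n -> R) (metric_dv : is_borel_metric_on L dv)
    (d : measure_display) (Omega : measurableType d) (P : probability Omega R)
    (lam : forall N : nat, 'I_N -> Omega -> 'rV[R]_n)
    (sampling : is_sampling_rule L lam)
    (consistent : consistent_rule L mu dv P lam)
    (tessellation : {ae P, forall w, forall N,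
      is_voronoi_tessellation L dv (fun j : 'I_N => lam N j w) mu})
    (A : set 'rV[R]_n) (borelA : borel_on L A)
    (boundaryA : mu (boundary_in L A) = 0%E) :
  exists I : forall M : nat, 'I_M.+1 -> set 'rV[R]_m,
    [/\ forall M, is_borel_partition (outputs L Q) (I M),
        (\int[push_volume L Q mu]_(q in outputs L Q)
           `|simple_density (push_volume L Q mu) PD (I M) q - rhoD q|%:E)%E
          @[M --> \oo] --> 0%E
      & {ae P, forall w,
          (fun NM : nat * nat =>
             (counting_measure L Q mu PD (I NM.2) dv
                (fun j : 'I_NM.1 => lam NM.1 j w) A)%:E)
            @ filter_prod \oo \oo --> inverse_measure muC PD A}].
Proof.
pose D : set (borelRV R m) := outputs L Q.
have mL := borel_compact n L compactL.
have mQ := regular_measurable L Q regularQ compactL.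
have mD : measurable D := borel_compact m _ (compact_outputs L Q regularQ compactL).
pose muD := image_measure_of mu L (Q : borelRV R n -> borelRV R m) mL mQ.
have density F : measurable F -> F `<=` D -> PD F = (\int[muD]_(q in F) (rhoD q)%:E)%E.
  by move=> mF FD; apply: rhoD_density; exact: borel_on_measurable.
have muD_fin : (muD D < +oo)%E.
  by apply: le_lt_trans finite_mu; apply: le_measure; rewrite ?inE//; exact: (mQ mL).
have intrho : muD.-integrable D (EFin \o rhoD).
  apply/integrableP; split; first exact/measurable_EFinP.
  suff -> : (\int[muD]_(q in D) `|(EFin \o rhoD) q| = 1)%E by rewrite ltry.
  rewrite -PD_outputs density//; apply: eq_integral => q /[!inE] Dq.
  by rewrite gee0_abs// lee_fin rhoD_ge0.
(* The partition depends on [rhoD] alone, neither on [A] nor on the samples. *)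
pose I := @level_set _ (borelRV R m) R D rhoD.
have mI M i : measurable (I M i) by exact: measurable_level_set muD D rhoD mD intrho M i.
have ID M i : I M i `<=` D by move=> q [].
have L1_cvg : (\int[muD]_(q in D)
    `|simple_density (push_volume L Q mu) PD (I M) q - rhoD q|%:E)%E
    @[M --> \oo] --> 0%E.
  have := level_average_cvg muD D rhoD mD muD_fin rhoD_ge0 intrho.
  apply: cvg_trans; apply: near_eq_cvg; apply: nearW => M.
  apply: eq_integral => q _; congr (`|_ - _|%:E); apply: eq_bigr => i _.
  by rewrite density.
exists I; split=> //.
- move=> M; split.
  + by move=> i; exact: borel_on_measurable.
  + exact: (bigcup_level_set D rhoD rhoD_ge0 M).
  + exact: (trivIset_level_set D rhoD M).
have AL := borel_on_sub _ _ _ borelA.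
have mA : measurable (A : set (borelRV R n)) by exact: measurable_borel_on borelA.
have PD_outC : PD (~` D) = 0%E by rewrite probability_setC// PD_outputs subee.
rewrite (inverse_measureE L Q mu mL mQ mD muC disintegration finite_mu PD PD_ac
  rhoD measurable_rhoD rhoD_ge0 density PD_outC A borelA).
set p := (\int[mu]_(x in A) (rhoD (Q x))%:E)%E.
pose f (x : borelRV R n) := rhoD (Q x).
have f0 x : L x -> 0 <= f x by move=> Lx; apply: rhoD_ge0; exists x.
have LD : Q @` L `<=` D by [].
have mf : measurable_fun (L : set (borelRV R n)) f.
  exact (@measurable_comp _ _ _ (borelRV R n) (borelRV R m) R D rhoD L
    (Q : borelRV R n -> borelRV R m) mD LD measurable_rhoD mQ).
(* Moves integrals from the outputs to [L], where the coverage lives. *)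
have integralQ (h : borelRV R m -> \bar R) : measurable_fun D h ->
    (forall q, D q -> 0 <= h q)%E ->
    (\int[muD]_(q in D) h q = \int[mu]_(x in L) h (Q x))%E.
  move=> mh h0; rewrite integral_mkcond.
  have mhT : measurable_fun setT (h \_ D) by apply/(measurable_restrictT _ mD).
  have hT0 q : (0 <= (h \_ D) q)%E.
    by rewrite patchE; case: ifPn => // /[!inE] /h0.
  rewrite (ge0_integral_image_measure mu L (Q : borelRV R n -> borelRV R m) mL mQ _ mhT hT0).
  by apply: eq_integral => x /[!inE] Lx; rewrite patchE mem_set//; exists x.
have intf : mu.-integrable L (EFin \o f).
  apply/integrableP; split; first exact/measurable_EFinP.
  have /integrableP[mr] := intrho.
  rewrite integralQ//; exact: measurableT_comp.
have p_fin : p \is a fin_num.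
  by apply: integrable_fin_num => //; exact: integrableS intf.
pose g M (x : borelRV R n) :=
  simple_density (push_volume L Q mu) PD (I M) (Q x).
have msd M := measurable_simple_density PD (I M) (mI M) (push_volume L Q mu).
have sd0 M q := simple_density_ge0 PD (fun F => measure_ge0 PD F) (I M)
  (push_volume L Q mu) q (fun F => measure_ge0 muD F).
have mg M : measurable_fun (L : set (borelRV R n)) (g M).
  exact (@measurable_comp _ _ _ (borelRV R n) (borelRV R m) R setT _ L
    (Q : borelRV R n -> borelRV R m) measurableT (@subsetT _ _) (msd M) mQ).
have gf_cvg : (\int[mu]_(x in L) `|g M x - f x|%:E)%E @[M --> \oo] --> 0%E.
  apply: cvg_trans L1_cvg; apply: near_eq_cvg; apply: nearW => M.
  rewrite integralQ//.
  apply/measurable_EFinP/measurableT_comp => //; apply: measurable_funB => //.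
  exact: measurable_funTS.
(* The intersection of two almost sure events; from here [w] is fixed and the argument is
   deterministic. *)
apply: filterS2 (consistent A borelA boundaryA) tessellation => w cover_cvg tess.
pose W N := voronoi_coverage L dv (fun j : 'I_N => lam N j w) A.
have lamL N j : L (lam N j w) by have [_] := sampling N j.
have mW N : measurable (W N : set (borelRV R n)).
  exact: measurable_voronoi_coverage.
have WL N : W N `<=` L by exact: voronoi_coverage_sub.
rewrite -(fineK p_fin); apply: cvg_EFin; first exact: nearW.
apply/cvgrPdist_lt => e e0.
have e20 : 0 < e / 2 by rewrite divr_gt0.
have [r r0 rP] := ge0_integral_absolutely_continuous mu L f (e / 2) mL intf f0 e20.
have near0 (u : (\bar R)^nat) (c : R) : u @ \oo --> 0%E -> 0 < c ->
    \forall k \near \oo, (u k < c%:E)%E.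
  move=> u0 c0; apply: (u0 [set y | (y < c%:E)%E]).
  by apply: open_nbhs_nbhs; split; [exact: open_ereal_lt_ereal|rewrite /= lte_fin].
(* The conditions on [N] and on [M] are independent, each bounding one error term by [e / 2]. The
   bound [0 < N] lets the cells cover [L]. *)
exists ([set N | (0 < N)%N /\ (mu (A `+` W N) < r%:E)%E],
  [set M | (\int[mu]_(x in L) `|g M x - f x|%:E < (e / 2)%:E)%E]).
  split=> /=; last exact: near0.
  by near=> N; split; near: N; [exact: nbhs_infty_gt|exact: near0].
move=> [N M] /= [[N0 AW] gf].
have AWL : A `+` W N `<=` L by move=> x [[/AL]|[/WL]].
have AWf := rP _ (measurable_setY _ _ mA (mW N)) AWL AW.
have [] := ge0_le_integral_dist mu L A (W N) f (g M) mL mA (mW N) AL (@WL N) mf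
  (mg M) f0 (fun x _ => sd0 M (Q x)).
have -> : (\int[mu]_(x in W N) (g M x)%:E =
    (counting_measure L Q mu PD (I M) dv (fun j : 'I_N => lam N j w) A)%:E)%E.
  by rewrite counting_measureE.
rewrite -[(\int[mu]_(x in A) (f x)%:E)%E]/p -(fineK p_fin).
apply: lt_dist_EFin; rewrite (splitr e) EFinD; exact: lteD.
Unshelve. all: by end_near. Qed.
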